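(* Let $N\ge 1$ and let $D$ be a signed diagram on the nodes $1,\dots,N-1$. Let $D+$ (respectively $D-$) be the signed diagram on the nodes $1,\dots,N$ obtained by adjoining a node $N$ with sign $+$ (respectively $-$) at the end of $D$. Then the sibling diagram demipotents $C_{D+}$ and $C_{D-}$ commute and are orthogonal in $\mathbb{C}H_0(S_{N+1})$: $$C_{D-}C_{D+}=C_{D+}C_{D-}=0.$$ Equivalently, $$C_DC_{D+}=C_{D+}C_D=C_{D+}^2\quad\text{and}\quad C_DC_{D-}=C_{D-}C_D=C_{D-}^2 .$$
   Context: The $0$-Hecke monoid $H_0(S_N)$ is generated by $\pi_1,\dots,\pi_{N-1}$ with relations $\pi_i^2=\pi_i$; $\pi_i\pi_j=\pi_j\pi_i$ for $|i-j|>1$; $\pi_i\pi_{i+1}\pi_i=\pi_{i+1}\pi_i\pi_{i+1}$. Its elements are indexed by permutations: $\sigma\in S_N$ corresponds to $\pi_{i_1}\cdots\pi_{i_k}$ for any reduced word $s_{i_1}\cdots s_{i_k}$ of $\sigma$. The $0$-Hecke algebra $\mathbb{C}H_0(S_N)$ is its monoid algebra over $\mathbb{C}$. $\mathbb{C}H_0(S_N)$ is identified with the subalgebra of $\mathbb{C}H_0(S_{N+1})$ generated by $\pi_1,\dots,\pi_{N-1}$. Put $\bar\pi_i=1-\pi_i$; the $\bar\pi_i$ satisfy the same relations, and $\Psi$ is the algebra automorphism with $\Psi(\pi_i)=\bar\pi_i$. For a set $J$ of indices of generators, $w_J^+$ is the longest element of the submonoid generated by $\{\pi_i : i\in J\}$,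 and $w_J^-=\Psi(w_J^+)$. A signed diagram $D$ on the nodes $1,\dots,n$ is an assignment of a sign $+$ or $-$ to each node $1,\dots,n$ (for $n=0$ the empty diagram). Let $P_1,\dots,P_m$ be the maximal intervals of consecutive nodes with the same sign, listed in increasing order, and let $sgn(k)$ be the common sign on $P_k$. Set $L_D=w_{P_1}^{sgn(1)}w_{P_2}^{sgn(2)}\cdots w_{P_m}^{sgn(m)}$ and $R_D=w_{P_m}^{sgn(m)}w_{P_{m-1}}^{sgn(m-1)}\cdots w_{P_1}^{sgn(1)}$. The diagram demipotent is $C_D=L_DR_D$ (equal to $1$ for the empty diagram). *)

(* Defs.v *)
From HB Require Import structures.
From mathcomp Require Import all_boot all_order all_algebra.
From mathcomp Require Import generic_quotient finmap.
From mathcomp Require Import boolp classical_sets reals.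
From mathcomp Require Import complex.
From mathcomp Require Import monalg.

Set Implicit Arguments.
Unset Strict Implicit.
Unset Printing Implicit Defensive.

Import GRing.Theory.
Local Open Scope quotient_scope.
Local Open Scope ring_scope.

(* Everything is indexed by the number n of generators, so that n stands for  *)
(* the symmetric group S_(n+1).  The ordinal i : 'I_n stands for the node     *)
(* (or generator) number i + 1.                                               *)

Section HeckeMonoid.
Variable n : nat.
Implicit Types (i j : 'I_n) (s t u v : seq 'I_n).

Inductive hecke_rel : seq 'I_n -> seq 'I_n -> Prop :=
| hecke_idem i : hecke_rel [:: i; i] [:: i]
| hecke_comm i j : (i.+1 < j)%N -> hecke_rel [:: i; j] [:: j; i]
| hecke_braid i j : j = i.+1 :> nat -> hecke_rel [:: i; j; i] [:: j; i; j].

(* The congruence on the free monoid generated by hecke_rel. *)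
Inductive hecke_cong : seq 'I_n -> seq 'I_n -> Prop :=
| hecke_cong_rel u v s t :
    hecke_rel s t -> hecke_cong (u ++ s ++ v) (u ++ t ++ v)
| hecke_cong_refl s : hecke_cong s s
| hecke_cong_sym s t : hecke_cong s t -> hecke_cong t s
| hecke_cong_trans s t u :
    hecke_cong s t -> hecke_cong t u -> hecke_cong s u.

Definition hecke_eqb s t : bool := `[< hecke_cong s t >].

Lemma hecke_eqb_refl : reflexive hecke_eqb.
Proof. by move=> s; apply/asboolP; apply: hecke_cong_refl. Qed.

Lemma hecke_eqb_sym : symmetric hecke_eqb.
Proof.
by move=> s t; apply/asboolP/asboolP; apply: hecke_cong_sym.
Qed.

Lemma hecke_eqb_trans : transitive hecke_eqb.
Proof.
move=> t s u /asboolP st /asboolP tu; apply/asboolP.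
exact: hecke_cong_trans st tu.
Qed.

Canonical hecke_equiv :=
  EquivRel hecke_eqb hecke_eqb_refl hecke_eqb_sym hecke_eqb_trans.

Definition hecke : Type := {eq_quot hecke_equiv}.
HB.instance Definition _ := Choice.on hecke.
HB.instance Definition _ := EqQuotient.on hecke.

End HeckeMonoid.

(* The element represented by the word s. *)
HB.lock Definition hword (n : nat) (s : seq 'I_n) : hecke n := \pi_(hecke n) s.

Section HeckeMonoidTheory.
Variable n : nat.
Implicit Types (s t u v : seq 'I_n).

Local Notation hword := (@hword n).

Lemma hwordP s t : hword s = hword t <-> hecke_cong s t.
Proof.
rewrite hword.unlock; split=> [/eqmodP/asboolP //|st].
by apply/eqmodP/asboolP.
Qed.

Lemma hecke_cong_cat s s' t t' :
  hecke_cong s s' -> hecke_cong t t' -> hecke_cong (s ++ t) (s' ++ t').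
Proof.
move=> ss' tt'; apply: (@hecke_cong_trans _ _ (s' ++ t)).
  elim: {tt' t'} ss' => {s s'}.
  - move=> u v s t0 st; rewrite -!catA; exact: hecke_cong_rel.
  - by move=> s; apply: hecke_cong_refl.
  - by move=> s t0 _ IH; apply: hecke_cong_sym.
  - by move=> s t0 u _ IH1 _; apply: hecke_cong_trans.
elim: {ss' s} tt' => {t t'}.
- move=> u v s t0 st; rewrite !(catA s' u); exact: hecke_cong_rel.
- by move=> s; apply: hecke_cong_refl.
- by move=> s t0 _ IH; apply: hecke_cong_sym.
- by move=> s t0 u _ IH1 _; apply: hecke_cong_trans.
Qed.

Definition hone : hecke n := hword [::].
Definition hmul (x y : hecke n) : hecke n := hword (repr x ++ repr y).

Lemma hword_repr x : hword (repr x) = x.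
Proof. by rewrite hword.unlock reprK. Qed.

Lemma hword_cat s t : hword (s ++ t) = hmul (hword s) (hword t).
Proof.
by apply/hwordP/hecke_cong_cat; apply/hwordP; rewrite hword_repr.
Qed.

Lemma hmulA : associative hmul.
Proof.
move=> x y z; rewrite -(hword_repr x) -(hword_repr y) -(hword_repr z).
by rewrite -!hword_cat catA.
Qed.

Lemma hmul1 : left_id hone hmul.
Proof. by move=> x; rewrite -(hword_repr x) -hword_cat. Qed.

Lemma hmulr1 : right_id hone hmul.
Proof. by move=> x; rewrite -(hword_repr x) -hword_cat cats0. Qed.

Lemma hecke_cong_nil s t : hecke_cong s t -> (s == [::]) = (t == [::]).
Proof.
elim=> {s t} //.
- by move=> u v s t; case=> *; rewrite -!size_eq0 !size_cat /= !addnS.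
- by move=> s t u _ -> _ ->.
Qed.

Lemma hmul_eq1 x y : hmul x y = hone -> x = hone /\ y = hone.
Proof.
move=> /hwordP /hecke_cong_nil; rewrite eqxx -size_eq0 size_cat addn_eq0.
move=> /andP[/nilP x0 /nilP y0].
by rewrite -(hword_repr x) -(hword_repr y) x0 y0.
Qed.

HB.instance Definition _ :=
  Choice_isMonomialDef.Build (hecke n) hmulA hmul1 hmulr1 hmul_eq1.

Lemma hlength_exists (x : hecke n) :
  exists k, `[< exists s, size s = k /\ hword s = x >].
Proof.
by exists (size (repr x)); apply/asboolP; exists (repr x); rewrite hword_repr.
Qed.

(* The minimal length of a word representing x; the reduced words of a        *)
(* permutation are the words of minimal length for the associated element.    *)
Definition hlength (x : hecke n) : nat := ex_minn (hlength_exists x).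

Definition in_submonoid (J : {set 'I_n}) (x : hecke n) : Prop :=
  exists s, all (fun i => i \in J) s /\ x = hword s.

(* The default value of xget is irrelevant, since there is a unique longest   *)
(* element.                                                                   *)
Definition longest (J : {set 'I_n}) : hecke n :=
  xget hone [set x | in_submonoid J x /\
    forall y, in_submonoid J y -> (hlength y <= hlength x)%N].

End HeckeMonoidTheory.

Lemma malg_scaleAr (M : monomType) (K : comNzRingType) (c : K)
  (a b : {malg K[M]}) : c *: (a * b) = a * (c *: b).
Proof.
apply/malgP=> k; rewrite mcoeffZ.
rewrite (@mcoeffMlw _ _ (msupp a) (msupp b) a (c *: b)) //; last first.
  exact: msuppZ_le.
rewrite mcoeffMl mulr_sumr; apply: eq_bigr => i _.
rewrite mulr_sumr; apply: eq_bigr => j _.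
by rewrite mcoeffZ mulrnAr mulrCA.
Qed.

Section HeckeAlgebra.
Variables (K : comNzRingType) (n : nat).

Definition heckealg : Type := {malg K[hecke n]}.
HB.instance Definition _ := GRing.Lalgebra.on heckealg.

HB.instance Definition _ :=
  GRing.Lalgebra_isAlgebra.Build K heckealg (@malg_scaleAr (hecke n) K).

End HeckeAlgebra.

HB.lock Definition hbasis (K : comNzRingType) (n : nat) (x : hecke n) :
  heckealg K n := << x >>.

Definition hgen (K : comNzRingType) (n : nat) (i : 'I_n) : heckealg K n :=
  hbasis K (hword [:: i]).

(* The linear extension of s |-> \prod_(i <- s) f i; it is the algebra        *)
(* morphism sending hgen i to f i when f satisfies the defining relations.    *)
HB.lock Definition hecke_extend (K : comNzRingType) (n : nat) (A : algType K)
    (f : 'I_n -> A) : heckealg K n -> A :=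
  mmap (in_alg A) (fun x : hecke n => \prod_(i <- repr x) f i).

Section Extension.
Variables (K : comNzRingType) (n : nat) (A : algType K) (f : 'I_n -> A).

Definition hecke_compatible : Prop :=
  [/\ forall i, f i * f i = f i,
      forall i j : 'I_n, (i.+1 < j)%N -> f i * f j = f j * f i
    & forall i j : 'I_n, j = i.+1 :> nat -> f i * f j * f i = f j * f i * f j].

Local Notation hecke_extend := (hecke_extend f).

Hypothesis fP : hecke_compatible.

Lemma hecke_cong_prod s t :
  hecke_cong s t -> \prod_(i <- s) f i = \prod_(i <- t) f i.
Proof.
have [idem comm braid] := fP.
elim=> {s t} // => [u v s t st|s t u _ -> _ ->] //.
rewrite !big_cat /=; congr (_ * (_ * _)).
case: st => [i|i j ij|i j ij]; rewrite !big_cons big_nil !mulr1.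
- exact: idem.
- exact: comm.
- by rewrite !mulrA braid.
Qed.

Lemma prod_hword s :
  \prod_(i <- repr (hword s)) f i = \prod_(i <- s) f i.
Proof. by apply/hecke_cong_prod/hwordP; rewrite hword_repr. Qed.

Let h (x : hecke n) : A := \prod_(i <- repr x) f i.

Let h_mmorphism : mmorphism h.
Proof.
split=> [x y|]; rewrite /h.
- by rewrite [mmul x y]/(hmul x y) prod_hword big_cat.
- by rewrite [mone]/(hone n) prod_hword big_nil.
Qed.

HB.instance Definition _ := isMultiplicative.Build (hecke n) A h h_mmorphism.

Lemma hecke_extend_monoid_morphism : monoid_morphism hecke_extend.
Proof.
rewrite hecke_extend.unlock; have [] := @commr_mmap_is_multiplicative _ _ _ (in_alg A) h.
  move=> g m m'; rewrite /GRing.comm /= -scalerAl -scalerAr.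
  by rewrite mul1r mulr1.
by [].
Qed.

Lemma hecke_extend_zmod_morphism : zmod_morphism hecke_extend.
Proof. rewrite hecke_extend.unlock; exact: (raddfB (mmap (in_alg A) h)). Qed.

Lemma hecke_extend_scalable : scalable hecke_extend.
Proof.
rewrite hecke_extend.unlock => c u; have := @mmapZ _ _ _ (in_alg A) h c u.
by rewrite /= mulr_algl.
Qed.

Lemma hecke_extend_hword s :
  hecke_extend (hbasis K (hword s)) = \prod_(i <- s) f i.
Proof.
by rewrite hecke_extend.unlock hbasis.unlock mmapU /= scale1r mul1r prod_hword.
Qed.

Lemma hecke_extend_hgen i : hecke_extend (hgen K i) = f i.
Proof. by rewrite hecke_extend_hword big_seq1. Qed.

End Extension.

Section Maps.
Variables (K : comNzRingType) (n : nat).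

(* The automorphism Psi, with Psi (hgen i) = 1 - hgen i. *)
Definition hPsi : heckealg K n -> heckealg K n :=
  hecke_extend (fun i => 1 - hgen K i).

(* The identification of CH_0(S_(n+1)) with the subalgebra of CH_0(S_(n+2))   *)
(* generated by all the generators but the last one.                          *)
Definition hincl : heckealg K n -> heckealg K n.+1 :=
  hecke_extend (fun i => hgen K (widen_ord (leqnSn n) i)).

End Maps.

Lemma compl_braid (A : nzRingType) (a b : A) :
    a * a = a -> b * b = b -> a * b * a = b * a * b ->
  (1 - a) * (1 - b) * (1 - a) = (1 - b) * (1 - a) * (1 - b).
Proof.
have aux (c d : A) : c * c = c ->
    (1 - c) * (1 - d) * (1 - c) = 1 - c - d + c * d + d * c - c * d * c.
  move=> cc; have pp : (1 - c) * (1 - c) = 1 - c.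
    by rewrite mulrBl mul1r mulrBr mulr1 cc subrr subr0.
  rewrite [(1 - c) * (1 - d)]mulrBr mulr1 [LHS]mulrBl pp.
  rewrite [(1 - c) * d]mulrBl mul1r mulrBr mulr1 mulrBl.
  by rewrite !opprD !opprK !addrA.
move=> aa bb aba; rewrite !aux // -aba; congr (_ - _).
by rewrite [1 - b - a]addrAC [RHS]addrAC.
Qed.

Section MapsTheory.
Variable K : comNzRingType.

Lemma hbasisM n (x y : hecke n) :
  hbasis K x * hbasis K y = hbasis K (mmul x y).
Proof. by rewrite hbasis.unlock malgME !msuppU1 !big_seq_fset1 !mcoeffUU mulr1. Qed.

Lemma hbasis1 n : hbasis K (hword [::] : hecke n) = 1.
Proof. by rewrite hbasis.unlock. Qed.

Lemma hgen_compatible n : hecke_compatible (hgen K (n := n)).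
Proof.
have hw (s t : seq 'I_n) :
    hbasis K (hword s) * hbasis K (hword t) = hbasis K (hword (s ++ t)).
  by rewrite hbasisM hword_cat.
have rel s t : hecke_rel s t -> @hword n s = hword t.
  by move=> st; apply/hwordP; rewrite -[s]cats0 -[t]cats0; apply: (@hecke_cong_rel _ [::]).
split=> [i|i j ij|i j ij]; rewrite /hgen !hw; congr hbasis; apply: rel.
- exact: hecke_idem.
- exact: hecke_comm.
- exact: hecke_braid.
Qed.

Lemma hPsi_compatible n :
  hecke_compatible (fun i : 'I_n => 1 - hgen K i).
Proof.
have [idem comm braid] := hgen_compatible n.
split=> [i|i j ij|i j ij].
- by rewrite mulrBl mul1r mulrBr mulr1 idem subrr subr0.
- have cij : GRing.comm (hgen K i) (hgen K j) by exact: comm.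
  apply: commrB; first exact: commr1.
  by apply/commr_sym/commrB; [exact: commr1 | exact/commr_sym].
- by apply: compl_braid; [exact: idem | exact: idem | exact: braid].
Qed.

HB.instance Definition _ n := GRing.isZmodMorphism.Build _ _ (@hPsi K n)
  (hecke_extend_zmod_morphism _).
HB.instance Definition _ n := GRing.isMonoidMorphism.Build _ _ (@hPsi K n)
  (hecke_extend_monoid_morphism (@hPsi_compatible n)).
HB.instance Definition _ n := GRing.isScalable.Build K _ _ _ (@hPsi K n)
  (hecke_extend_scalable (@hPsi_compatible n)).

Lemma hPsi_hgen n (i : 'I_n) : hPsi (hgen K i) = 1 - hgen K i.
Proof. exact: (hecke_extend_hgen (@hPsi_compatible n)). Qed.

Lemma hincl_compatible n :
  hecke_compatible (fun i : 'I_n => hgen K (widen_ord (leqnSn n) i)).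
Proof.
have [idem comm braid] := hgen_compatible n.+1.
by split=> [i|i j ij|i j ij]; [exact: idem | exact: comm | exact: braid].
Qed.

HB.instance Definition _ n := GRing.isZmodMorphism.Build _ _ (@hincl K n)
  (hecke_extend_zmod_morphism _).
HB.instance Definition _ n := GRing.isMonoidMorphism.Build _ _ (@hincl K n)
  (hecke_extend_monoid_morphism (@hincl_compatible n)).
HB.instance Definition _ n := GRing.isScalable.Build K _ _ _ (@hincl K n)
  (hecke_extend_scalable (@hincl_compatible n)).

Lemma hincl_hgen n (i : 'I_n) :
  hincl (hgen K i) = hgen K (widen_ord (leqnSn n) i).
Proof. exact: (hecke_extend_hgen (@hincl_compatible n)). Qed.

Lemma heckealg_ind n (P : heckealg K n -> Prop) :
    (forall u v, P u -> P v -> P (u + v)) -> (forall c u, P u -> P (c *: u)) ->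
    P 1 -> (forall i u, P u -> P (hgen K i * u)) ->
  forall u, P u.
Proof.
move=> PD PZ P1 PM u; rewrite (monalgE u).
elim/big_ind: _ => [||x _].
- by rewrite -(scale0r (1 : heckealg K n)); apply: PZ.
- exact: PD.
have -> : << u@_x *g x >> = u@_x *: hbasis K x.
  by rewrite hbasis.unlock; apply/malgP=> k; rewrite mcoeffZ !mcoeffU mulrnAr mulr1.
apply: PZ; rewrite -(hword_repr x); elim: (repr x) => [|i s IHs].
  by rewrite hbasis1.
by rewrite -cat1s hword_cat -hbasisM; apply: PM.
Qed.

Lemma hPsiK n : involutive (@hPsi K n).
Proof.
elim/heckealg_ind => [u v IHu IHv|c u IHu||i u IHu].
- by rewrite !raddfD /= IHu IHv.
- by rewrite !linearZ /= IHu.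
- by rewrite !rmorph1.
by rewrite !rmorphM /= IHu hPsi_hgen rmorphB rmorph1 /= hPsi_hgen subKr.
Qed.

(* Sending the last generator to 1 defines a retraction of hincl. *)
Lemma hincl_inj n : injective (@hincl K n).
Proof.
pose f (i : 'I_n.+1) : heckealg K n := if insub (val i) is Some j then hgen K j else 1.
have fE (i : 'I_n) : f (widen_ord (leqnSn n) i) = hgen K i by rewrite /f /= valK.
have [idem comm braid] := hgen_compatible n.
have fP : hecke_compatible f.
  split=> [i|i j ij|i j ij]; rewrite /f.
  - by case: insub => [k|]; rewrite ?mulr1.
  - case: insubP => [k _ kE|_]; last by rewrite mul1r mulr1.
    case: insubP => [l _ lE|_]; last by rewrite mul1r mulr1.
    by apply: comm; rewrite kE lE.
  case: insubP => [k _ kE|/negP ni]; case: insubP => [l _ lE|_].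
  - by apply: braid; rewrite kE lE.
  - by rewrite mulr1 !mul1r idem mulr1.
  - by case: ni; have := ltn_ord l; rewrite lE /= ij; exact: ltnW.
  - by rewrite !mulr1.
apply: (can_inj (g := hecke_extend f)).
have fD := hecke_extend_zmod_morphism f.
have [f1 fM] := hecke_extend_monoid_morphism fP.
have fZ := hecke_extend_scalable fP.
elim/heckealg_ind => [u v IHu IHv|c u IHu||i u IHu].
- have f0 : hecke_extend f 0 = 0 by rewrite -(subrr 0) fD subrr.
  by rewrite raddfD /= -[hincl v]opprK fD -[- hincl v]sub0r fD f0 sub0r opprK IHu IHv.
- by rewrite linearZ /= fZ IHu.
- by rewrite rmorph1 f1.
- by rewrite rmorphM /= fM IHu hincl_hgen (hecke_extend_hgen fP) fE.
Qed.

End MapsTheory.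

Section DiagramDemipotents.
Variable K : comNzRingType.

(* The sign of the node i + 1 is + if tnth D i is true, and - otherwise. *)
Definition sdiagram (n : nat) : Type := n.-tuple bool.

Definition adjoin_node n (D : sdiagram n) (eps : bool) : sdiagram n.+1 :=
  rcons_tuple D eps.

Variables (n : nat) (D : sdiagram n).

(* The maximal interval of nodes with the same sign that contains i. *)
Definition block (i : 'I_n) : {set 'I_n} :=
  [set j : 'I_n | [forall k : 'I_n,
     (minn i j <= k <= maxn i j)%N ==> (tnth D k == tnth D i)]].

(* The first nodes of the blocks, which index the blocks. *)
Definition block_first (i : 'I_n) : bool := [forall j in block i, (i <= j)%N].

Definition wsign (eps : bool) (J : {set 'I_n}) : heckealg K n :=
  let w := hbasis K (longest J) in if eps then w else hPsi w.

Definition L_diagram : heckealg K n :=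
  \prod_(i <- enum 'I_n | block_first i) wsign (tnth D i) (block i).

Definition R_diagram : heckealg K n :=
  \prod_(i <- rev (enum 'I_n) | block_first i) wsign (tnth D i) (block i).

Definition C_diagram : heckealg K n := L_diagram * R_diagram.

End DiagramDemipotents.

(* Main.v *)
From HB Require Import structures.
Require Import Defs.
From mathcomp Require Import all_boot all_order all_algebra.
From mathcomp Require Import boolp classical_sets monalg zify.
From mathcomp Require Import reals complex.

(* Let p_1, p_2, ... satisfy the 0-Hecke relations, and let b = p_N, with     *)
(* bbar = 1 - b.  Since w_(P + N) = w_P b w_P, adjoining a signed node gives  *)
(* C_(D+) = L_D b R_D and C_(D-) = L_D bbar R_D, whose sum is C_D.            *)
(* Orthogonality then amounts to L_D b (R_D L_D) bbar R_D = 0 and its mirror  *)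
(* image.  Let a be the last node of D and write                              *)
(*   R_D L_D = m0 + sum u a v                                                 *)
(* with m0, u, v generated by the nodes before a.  Those commute with b, and  *)
(* b a bbar = abar b a, so it is enough that                                  *)
(*   sum L_D u (a y abar) v R_D = 0 = sum L_D u (abar y a) v R_D              *)
(* for y = b.  This is proved for every y at all, by adding one block of equal*)
(* signs at a time.  If w is the longest element of a block following the     *)
(* node g, then w g w = h c h with c the last node of the block and h the     *)
(* longest element of the block shifted by one, and                           *)
(*   w h (c y cbar) h w = g X gbar  for some X,                               *)
(* because w h c, c h w, h w g and g w h are all equal to the longest element *)
(* of the block extended by g.                                                *)

Set Implicit Arguments.
Unset Strict Implicit.
Unset Printing Implicit Defensive.

Import GRing.Theory.
Local Open Scope ring_scope.
Local Open Scope complex_scope.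

(** The computation sketched above is made in an arbitrary ring with a family satisfying
    [hecke_family]. This covers the generators, their complements and the opposite ring at once. The
    condition on R_D L_D is [orth_decomp]. It holds for one block ([orth_decomp_first]), survives
    the addition of a block ([orth_decomp_step]) and the exchange of generators with their
    complements ([orth_decomp_compl]), hence holds for every nonempty diagram
    ([orth_decomp_diagram]). The braid relation between the last node and the new one then yields
    orthogonality ([orth_decomp_orthogonal]), and the identities with C_D follow because C_D is the
    sum of the two siblings ([Cprod_siblings]).

    It remains to identify [wlong] with the longest elements, which are defined by length. Normal
    forms given by Lehmer codes compute the length ([hlength_code]). Hence an element of the
    submonoid on J that absorbs every generator of J is the longest one ([longestE]), and [wlong]
    has this property ([q_wlong]). *)

Definition hecke_family (A : nzRingType) (q : nat -> A) : Prop :=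
  [/\ forall i, q i * q i = q i,
      forall i j, (i.+1 < j)%N -> q i * q j = q j * q i
    & forall i, q i * q i.+1 * q i = q i.+1 * q i * q i.+1].

Lemma hecke_family_compl (A : nzRingType) (q : nat -> A) :
  hecke_family q -> hecke_family (fun i => 1 - q i).
Proof.
case=> idem comm braid; split=> [i|i j ij|i].
- by rewrite mulrBl mul1r mulrBr mulr1 idem subrr subr0.
- have cij : GRing.comm (q i) (q j) by exact: comm.
  apply: commrB; first exact: commr1.
  by apply/commr_sym/commrB; [exact: commr1 | exact/commr_sym].
- exact: compl_braid.
Qed.

(* The longest element of the parabolic submonoid on the nodes k, ..., k+l-1. *)
HB.lock Definition wlong (A : nzRingType) (q : nat -> A) (k l : nat) : A :=
  iteri l (fun i x => x * q (k + i)%N * x) 1.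

Lemma wlong0 (A : nzRingType) (q : nat -> A) k : wlong q k 0 = 1.
Proof. by rewrite wlong.unlock. Qed.

Lemma wlongS (A : nzRingType) (q : nat -> A) k l :
  wlong q k l.+1 = wlong q k l * q (k + l)%N * wlong q k l.
Proof. by rewrite wlong.unlock. Qed.

(** The recursion is palindromic, so reversing products fixes [wlong]. Each identity on one side
    thus yields its mirror image through [A^c]. *)
Lemma wlong_converse (A : nzRingType) (q : nat -> A) k l :
  @wlong A^c q k l = wlong q k l.
Proof.
by elim: l => [|l IHl]; rewrite ?wlong0 // !wlongS IHl [LHS](@mulrA A).
Qed.

Lemma wlong_rmorph (A B : nzRingType) (f : {rmorphism A -> B}) (q : nat -> A)
    (r : nat -> B) k l :
  (forall i, (k <= i < k + l)%N -> f (q i) = r i) ->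
  f (wlong q k l) = wlong r k l.
Proof.
elim: l => [|l IHl] qr; rewrite ?wlong0 ?rmorph1 // !wlongS !rmorphM /=.
by rewrite qr ?IHl // => [i ?|]; [apply: qr; lia | lia].
Qed.

Lemma hecke_family_converse (A : nzRingType) (q : nat -> A) :
  hecke_family q -> @hecke_family A^c q.
Proof.
case=> idem comm braid; split=> [|i j /comm qij|i] //.
by have := braid i; rewrite -!(@mulrA A) => qi; exact: qi.
Qed.

(** * Longest elements on intervals of nodes *)

Section LongestElement.
Variables (A : nzRingType) (q : nat -> A).
Hypothesis qP : hecke_family q.
Local Notation w := (wlong q).

Lemma wlong_comm x k l :
  (forall i, (k <= i < k + l)%N -> GRing.comm x (q i)) -> GRing.comm x (w k l).
Proof.
elim: l => [_|l IHl xq]; rewrite ?wlong0 ?wlongS; first exact: commr1.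
have xw : GRing.comm x (w k l) by apply: IHl => i ?; apply: xq; lia.
by apply: commrM => //; apply: commrM => //; apply: xq; lia.
Qed.

Lemma comm_q i j : (i.+1 < j)%N -> GRing.comm (q i) (q j).
Proof. by case: qP => _ + _; apply. Qed.

Lemma comm_q_wlong i k l : (i.+1 < k)%N || (k + l < i)%N -> 
  q i * w k l = w k l * q i.
Proof.
move=> ikl; apply: wlong_comm => j jkl.
case/orP: ikl => ?; first by apply: comm_q; lia.
by apply/commr_sym/comm_q; lia.
Qed.

Lemma wlong_absorbl x k l :
  (forall i, (k <= i < k + l)%N -> q i * x = x) -> w k l * x = x.
Proof.
elim: l => [_|l IHl qx]; rewrite ?wlong0 ?wlongS ?mul1r //.
have wx : w k l * x = x by apply: IHl => i ?; apply: qx; lia.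
by rewrite -mulrA wx -mulrA qx ?wx //; lia.
Qed.

(** Only the last generator t needs an argument. With w' = v d v, the product w' t w' collapses to v
    d t w', because v commutes with t and v w' = w'. Then t passes v, and t d t = d t d leaves a d
    that w' absorbs. *)
Lemma q_wlong k l i : (k <= i < k + l)%N -> q i * w k l = w k l.
Proof.
have [idem _ braid] := qP.
elim: l i => [|l IHl] i ikl; first lia.
have [il|il] := ltnP i (k + l); first by rewrite wlongS !mulrA IHl //; lia.
have {il ikl} -> : i = (k + l)%N by lia.
case: l IHl => [|l] IHl; first by rewrite wlongS wlong0 mul1r mulr1 idem.
pose d := q (k + l)%N; pose t := q (k + l.+1)%N; pose v := w k l.
pose w' := w k l.+1; have w'E : w' = v * d * v by exact: wlongS.
have vw' : v * w' = w' by apply: wlong_absorbl => j ?; apply: IHl; lia.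
have dw' : d * w' = w' by apply: IHl; lia.
have tv : t * v = v * t by apply: comm_q_wlong; lia.
have dtd : t * d * t = d * t * d by rewrite /t addnS -braid.
have w'tw' : w' * t * w' = v * d * t * w'.
  by rewrite {1}w'E -!mulrA (mulrA v t) -tv -!mulrA vw'.
rewrite [w k l.+2]wlongS -/w' -/t w'tw'.
transitivity (v * (t * d * t) * w'); first by rewrite !mulrA tv.
by rewrite dtd -!mulrA dw'.
Qed.

End LongestElement.

Section LongestElementTheory.
Variables (A : nzRingType) (q : nat -> A).
Hypothesis qP : hecke_family q.
Local Notation w := (wlong q).

Lemma wlong_q k l i : (k <= i < k + l)%N -> w k l * q i = w k l.
Proof.
move=> ikl; rewrite -wlong_converse.
exact: (q_wlong (hecke_family_converse qP) ikl).
Qed.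

Lemma wlong_absorbr x k l :
  (forall i, (k <= i < k + l)%N -> x * q i = x) -> x * w k l = x.
Proof.
move=> xq; rewrite -wlong_converse.
exact: (@wlong_absorbl A^c).
Qed.

Lemma wlong_subl k l k' l' :
  (k' <= k)%N -> (k + l <= k' + l')%N -> w k l * w k' l' = w k' l'.
Proof.
by move=> ? ?; apply: wlong_absorbl => i ?; apply: (q_wlong qP); lia.
Qed.

Lemma wlong_subr k l k' l' :
  (k' <= k)%N -> (k + l <= k' + l')%N -> w k' l' * w k l = w k' l'.
Proof.
by move=> ? ?; apply: wlong_absorbr => i ?; apply: wlong_q; lia.
Qed.

Lemma wlong_recl k l : w k l.+1 = w k.+1 l * q k * w k.+1 l.
Proof.
have [idem _ braid] := qP.
elim: l k => [|l IHl] k; first by rewrite wlongS !wlong0 addn0.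
pose W := w k l.+2; pose v1 := w k.+1 l.+1; pose X := v1 * q k * v1.
rewrite -[LHS]/W -[RHS]/X.
have WX : W * X = W.
  have Wv : W * v1 = W by apply: wlong_subr; lia.
  by rewrite /X !mulrA Wv wlong_q ?Wv //; lia.
(* X absorbs every generator of the block on the left, so W X is also X. *)
rewrite -WX; apply: wlong_absorbl => i ikl; have [ki|ik] := ltnP k i.
  by rewrite /X /v1 !mulrA (q_wlong qP) //; lia.
have {ikl ik} -> : i = k by lia.
pose g := q k; pose h := q k.+1; pose v := w k.+2 l.
have v1E : v1 = v * h * v by exact: IHl.
have vv1 : v * v1 = v1 by apply: wlong_subl; lia.
have hv1 : h * v1 = v1 by apply: (q_wlong qP); lia.
have gv : g * v = v * g by apply: (comm_q_wlong qP); lia.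
have XE : X = v * h * g * v1.
  by rewrite /X {1}v1E -/g -!mulrA (mulrA v g) -gv -!mulrA vv1.
rewrite XE -/g; transitivity (v * (g * h * g) * v1); first by rewrite !mulrA gv.
by rewrite braid -/g -/h -!mulrA hv1.
Qed.

(** The product of the two overlapping longest elements is one letter short of the longest element
    on their union, and the last generator on the left supplies that letter. *)
Lemma q_wlong_wlong k l :
  q (k + l)%N * w k l * w k.+1 l = w k l.+1.
Proof.
have [idem _ braid] := qP.
elim: l => [|l IHl]; first by rewrite wlongS !wlong0 mul1r mulr1.
pose d := q (k + l)%N; pose c := q (k + l.+1)%N.
pose u := w k l; pose v := w k.+1 l; pose W := w k l.+1.
have cu : c * u = u * c by apply: (comm_q_wlong qP); lia.
have uW : u * W = W by apply: wlong_subl; lia.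
have cdc : c * d * c = d * c * d by rewrite /c addnS -braid.
have dW : d * W = W by apply: (q_wlong qP); lia.
have WE : W = u * d * u by exact: wlongS.
have cuA x : c * (u * x) = u * (c * x) by rewrite !mulrA cu.
have uuA x : u * (u * x) = u * x by rewrite mulrA wlong_subl.
have cdcA x : c * (d * (c * x)) = d * (c * (d * x)) by rewrite !mulrA cdc.
have duv : d * (u * v) = W by rewrite mulrA.
rewrite [w k.+1 _]wlongS [w k l.+2]wlongS addSnnS -/c -/v -/W.
(* Once c has passed u, the factor d u v appears, which the induction hypothesis folds into W. *)
transitivity (u * (c * (W * (c * v)))).
  by rewrite -{2}duv WE -!mulrA cuA.
rewrite {1}WE -!mulrA cuA uuA -(cuA v) cdcA duv.
by rewrite -[in LHS]uW cuA !mulrA -WE.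
Qed.

(** This is [q_wlong_wlong] with both the product and the order of the nodes reversed. The opposite
    ring reverses only products, hence a separate induction, based on [wlong_recl]. *)
Lemma wlong_wlong_q k l :
  w k l * w k.+1 l * q k = w k l.+1.
Proof.
have [idem _ braid] := qP.
elim: l k => [|l IHl] k; first by rewrite wlongS !wlong0 addn0 !mulr1 mul1r.
pose g := q k; pose h := q k.+1; pose v := w k.+2 l; pose u := w k.+1 l.
pose u1 := w k.+1 l.+1.
have gv : g * v = v * g by apply: (comm_q_wlong qP); lia.
have u1v : u1 * v = u1 by apply: wlong_subr; lia.
have vv : v * v = v by apply: wlong_subl.
have u1E : u1 = v * h * v by exact: wlong_recl.
have uvh : u * v * h = u1 by exact: IHl.
have uv : g * h * g = h * g * h by exact: braid.
have gvA x : g * (v * x) = v * (g * x) by rewrite !mulrA gv.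
have vvA x : v * (v * x) = v * x by rewrite mulrA vv.
have ghgA x : g * (h * (g * x)) = h * (g * (h * x)) by rewrite !mulrA uv.
have uvhA x : u * (v * (h * x)) = u1 * x by rewrite -uvh !mulrA.
rewrite [w k l.+1]wlong_recl [w k l.+2]wlong_recl -/g -/u -/u1.
transitivity (u * (g * (u1 * (g * v)))).
  by rewrite [in LHS]u1E -[in RHS]uvh -!mulrA gv.
have vgv : v * (g * v) = g * v by rewrite gv vvA.
rewrite [in LHS]u1E -!mulrA gvA vgv ghgA uvhA.
by rewrite [X in _ = _ * (_ * X)]u1E -!mulrA gvA [u1 * (v * _)]mulrA u1v.
Qed.

End LongestElementTheory.

Section LongestElementMirror.
Variables (A : nzRingType) (q : nat -> A).
Hypothesis qP : hecke_family q.
Local Notation w := (wlong q).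

Lemma wlong_wlong_q_last k l : w k.+1 l * w k l * q (k + l)%N = w k l.+1.
Proof.
have := q_wlong_wlong (hecke_family_converse qP) k l.
by rewrite !wlong_converse -(@mulrA A) => <-.
Qed.

Lemma q_first_wlong_wlong k l : q k * w k.+1 l * w k l = w k l.+1.
Proof.
have := wlong_wlong_q (hecke_family_converse qP) k l.
by rewrite !wlong_converse -(@mulrA A) => <-.
Qed.

End LongestElementMirror.

(** * Orthogonality carried from block to block *)

Section OrthogonalDecomposition.
Variable A : nzRingType.
Implicit Types (q : nat -> A) (L R u v y : A).

Definition below q (a : nat) u : Prop :=
  forall j, (a < j)%N -> GRing.comm u (q j).

(* The elements generated by the nodes before a are only used through the    *)
(* commutation [below], which avoids describing that subalgebra.              *)
Definition orth_decomp q (a : nat) L R : Prop :=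
  exists (m0 : A) (s : seq (A * A)),
  [/\ below q a m0, {in s, forall uv, below q a uv.1 /\ below q a uv.2},
      R * L = m0 + \sum_(uv <- s) uv.1 * q a * uv.2 &
      forall y,
        \sum_(uv <- s) L * uv.1 * (q a * y * (1 - q a)) * uv.2 * R = 0 /\
        \sum_(uv <- s) L * uv.1 * ((1 - q a) * y * q a) * uv.2 * R = 0].

Lemma below_compl q a u : below q a u -> below (fun i => 1 - q i) a u.
Proof. by move=> uq j /uq ?; apply: commrB => //; exact: commr1. Qed.

Lemma belowN q a u : below q a u -> below q a (- u).
Proof. by move=> uq j /uq /commr_sym /commrN /commr_sym. Qed.

Lemma belowM q a u v : below q a u -> below q a v -> below q a (u * v).
Proof.
by move=> uq vq j aj; apply/commr_sym/commrM; apply/commr_sym; [apply: uq|apply: vq].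
Qed.

(** Since u a v = u v - u (1 - a) v, the terms u v move into m0 and each u changes sign; the two
    vanishing sums trade places. *)
Lemma orth_decomp_compl q a L R :
  orth_decomp q a L R -> orth_decomp (fun i => 1 - q i) a L R.
Proof.
case=> m0 [s [m0q sq RL LR0]].
exists (m0 + \sum_(uv <- s) uv.1 * uv.2), [seq (- uv.1, uv.2) | uv <- s]; split.
- apply: below_compl => j aj; apply/commr_sym/commrD; first exact/commr_sym/m0q.
  rewrite big_seq; apply: (big_ind (GRing.comm (q j))) => [|x y|uv /sq[uq vq]].
  + exact: commr0.
  + exact: commrD.
  by apply/commr_sym; apply: belowM aj.
- by move=> _ /mapP[uv /sq[uq vq] ->]; split; apply: below_compl => //; apply: belowN.
- rewrite RL big_map /= -addrA -big_split /=; congr (_ + _).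
  by apply: eq_bigr => uv _; rewrite mulNr mulrBr mulr1 mulNr mulrBl opprB addrC subrK.
- move=> y; rewrite !big_map subKr /=.
  have [LR1 LR2] := LR0 y; split; apply: oppr_inj; rewrite oppr0.
    rewrite -[RHS]LR2 -sumrN; apply: eq_bigr => uv _.
    by rewrite !(mulrN, mulNr) opprK.
  rewrite -[RHS]LR1 -sumrN; apply: eq_bigr => uv _.
  by rewrite !(mulrN, mulNr) opprK.
Qed.

Lemma below_wlong q a k l : hecke_family q -> (k + l <= a)%N -> below q a (wlong q k l).
Proof.
move=> qP kla j aj; apply/commr_sym/wlong_comm => i ikl.
by apply/commr_sym/comm_q => //; lia.
Qed.

(** Here R L = w = w' a w', and w absorbs w' and a on both sides, so 1 - a vanishes against w. *)
Lemma orth_decomp_first q l : hecke_family q ->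
  orth_decomp q l (wlong q 0 l.+1) (wlong q 0 l.+1).
Proof.
move=> qP; pose w := wlong q 0 l.+1; pose w' := wlong q 0 l.
have ww' : w * w' = w by apply: wlong_subr => //; lia.
have w'w : w' * w = w by apply: wlong_subl => //; lia.
have qw : q l * w = w by apply: q_wlong => //; lia.
have wq : w * q l = w by apply: wlong_q => //; lia.
exists 0, [:: (w', w')]; split.
- by move=> j _; apply/commr_sym/commr0.
- by move=> _ /[1!inE]/eqP -> /=; split; apply: below_wlong => //; lia.
- by rewrite wlong_subl // add0r big_seq1 /= wlongS.
move=> y; rewrite !big_seq1 /= -/w !ww' -!mulrA !w'w; split.
  by rewrite mulrBl mul1r qw subrr !mulr0.
by rewrite mulrA mulrBr mulr1 wq subrr mul0r.
Qed.

Lemma orth_decomp_step q k l L R : hecke_family q -> orth_decomp q k L R ->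
  orth_decomp q (k + l.+1) (L * wlong q k.+1 l.+1) (wlong q k.+1 l.+1 * R).
Proof.
move=> qP [m0 [s [m0q sq RL LR0]]].
have [idem _ _] := qP.
pose c := q (k + l.+1)%N; pose g := q k.
pose w := wlong q k.+1 l.+1; pose w' := wlong q k.+1 l.
pose h := wlong q k l.+1; pose W := wlong q k l.+2.
have wE : w = w' * c * w' by rewrite /w wlongS addSnnS.
have WE : W = h * c * h by exact: wlongS.
have wgw : w * g * w = W by rewrite /W wlong_recl.
have ww : w * w = w by apply: wlong_subl.
have ww' : w * w' = w by apply: wlong_subr => //; lia.
have w'w : w' * w = w by apply: wlong_subl => //; lia.
have cw : c * w = w by apply: q_wlong => //; lia.
have wc : w * c = w by apply: wlong_q => //; lia.
have cW : c * W = W by apply: q_wlong => //; lia.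
have Wc : W * c = W by apply: wlong_q => //; lia.
have gW : g * W = W by apply: q_wlong => //; lia.
have Wg : W * g = W by apply: wlong_q => //; lia.
have chw : c * h * w = W by exact: q_wlong_wlong.
have hwg : h * w * g = W by exact: wlong_wlong_q.
have whc : w * h * c = W by exact: wlong_wlong_q_last.
have gwh : g * w * h = W by exact: q_first_wlong_wlong.
have kw u : below q k u -> u * w = w * u.
  by move=> uq; apply: wlong_comm => i ?; apply: uq; lia.
have uq_trans u : below q k u -> below q (k + l.+1) u.
  by move=> uq j ?; apply: uq; lia.
have w'q : below q (k + l.+1) w' by apply: below_wlong => //; lia.
have hq : below q (k + l.+1) h by apply: below_wlong => //; lia.
(* Since m0, u and v commute with w, the product w R L w is m0 w plus the sum of u (w g w) v. The
   pairs come from w = w' c w' and w g w = h c h. *)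
pose pairs := (m0 * w', w') :: [seq (uv.1 * h, h * uv.2) | uv <- s].
exists 0, pairs; split.
- by move=> j _; apply/commr_sym/commr0.
- move=> _ /[1!inE] /predU1P[->|/mapP[uv /sq[/uq_trans uq /uq_trans vq] ->]] /=.
    by split=> //; apply: belowM => //; apply: uq_trans.
  by split; apply: belowM.
- rewrite -/w mulrA -[w * R * L]mulrA RL add0r mulrDr mulrDl big_cons big_map /=.
  congr (_ + _); first by rewrite -kw // -mulrA ww wE !mulrA.
  rewrite mulr_sumr mulr_suml !big_seq; apply: eq_bigr => uv /sq[uq vq].
  by rewrite !mulrA -kw // -!mulrA kw // !mulrA -(mulrA uv.1) -(mulrA uv.1) wgw WE !mulrA.
(* The first pair contributes w z w, which is zero. In the others w moves inwards past u and v,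
   which leaves a sum at the previous node g. *)
have sandwich z X Y : w * h * z * h * w = X * Y ->
    \sum_(uv <- s) L * uv.1 * (X * Y) * uv.2 * R = 0 -> w * z * w = 0 ->
  \sum_(uv <- pairs) (L * w) * uv.1 * z * uv.2 * (w * R) = 0.
  move=> whzhw LXYR0 wzw0; rewrite big_cons big_map /=.
  rewrite [X in X + _](_ : _ = 0) ?add0r.
    rewrite -[RHS]LXYR0 !big_seq; apply: eq_bigr => uv /sq[uq vq].
    by rewrite -whzhw !mulrA -(mulrA L w) -(kw _ uq) -(mulrA _ uv.2 w) (kw _ vq) !mulrA.
  transitivity (L * m0 * (w * w' * z * (w' * w)) * R).
    by rewrite !mulrA -(mulrA L w) -kw // !mulrA.
  by rewrite ww' w'w wzw0 mulr0 mul0r.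
move=> y; rewrite -/w -/c; split.
(* This value arises from w h c = W = g W on the left; on the right, 1 - g may be appended because
   (1 - c) h w g = 0. *)
- have [LR0y _] := LR0 (W * y * (1 - c) * h * w).
  apply: sandwich LR0y _; last first.
    by rewrite -!mulrA mulrBl mul1r cw subrr !mulr0.
  have chwg : (1 - c) * h * w * g = 0.
    by rewrite -!mulrA (mulrA h) hwg mulrBl mul1r cW subrr.
  transitivity (W * y * ((1 - c) * h * w * (1 - g))); last by rewrite !mulrA gW.
  by rewrite [_ * (1 - g)]mulrBr mulr1 chwg subr0 !mulrA whc.
- have [_ LR0y] := LR0 (w * h * (1 - c) * y * W).
  apply: sandwich LR0y _; last first.
    by rewrite !mulrA mulrBr mulr1 wc subrr !mul0r.
  have gwhc : g * (w * h * (1 - c)) = 0.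
    by rewrite !mulrA gwh mulrBr mulr1 Wc subrr.
  transitivity ((1 - g) * (w * h * (1 - c)) * y * W); last first.
    by rewrite -!mulrA Wg.
  by rewrite [(1 - g) * _]mulrBl mul1r gwhc subr0 -chw !mulrA.
Qed.

(** The m0 term dies because m0 commutes with b and b (1 - b) = 0. By the braid relation, the other
    terms are the two sums of [orth_decomp] at y = b. *)
Lemma orth_decomp_orthogonal q a L R : hecke_family q -> orth_decomp q a L R ->
  L * q a.+1 * R * (L * (1 - q a.+1) * R) = 0 /\
  L * (1 - q a.+1) * R * (L * q a.+1 * R) = 0.
Proof.
move=> qP [m0 [s [m0q sq RL LR0]]]; have [idem _ braid] := qP.
pose b := q a.+1; pose g := q a.
have sub b1 b2 : \sum_(uv <- s) L * (uv.1 * (b1 * g * b2) * uv.2) * R = 0 ->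
    b1 * b2 = 0 -> GRing.comm m0 b1 ->
    {in s, forall uv, GRing.comm uv.1 b1 /\ GRing.comm uv.2 b2} ->
  L * b1 * R * (L * b2 * R) = 0.
  move=> sum0 b12 m0b sb; transitivity (L * (b1 * (R * L) * b2) * R).
    by rewrite !mulrA.
  rewrite RL mulrDr mulrDl -m0b -(mulrA m0) b12 mulr0 add0r.
  rewrite -[RHS]sum0 mulr_sumr !(mulr_suml, mulr_sumr) !big_seq.
  apply: eq_bigr => uv /sb[ub vb].
  by rewrite !mulrA -(mulrA L b1) -ub -(mulrA _ uv.2 b2) vb !mulrA.
have bg1 : b * g * (1 - b) = (1 - g) * (b * g).
  by rewrite mulrBr mulrBl mulr1 mul1r -braid mulrA.
have bg2 : (1 - b) * g * b = g * b * (1 - g).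
  by rewrite mulrBl mul1r mulrBl mulrBr mulr1 -braid.
have bC u : below q a u -> GRing.comm u b /\ GRing.comm u (1 - b).
  by move=> uq; have ub := uq _ (ltnSn a); split=> //; apply: commrB => //; apply: commr1.
have [m0b m0b'] := bC _ m0q.
have [LR1 LR2] := LR0 b.
split; apply: sub => //.
- rewrite bg1 -[RHS]LR2; apply: eq_bigr => uv _; by rewrite !mulrA.
- by rewrite mulrBr mulr1 idem subrr.
- by move=> uv /sq[/bC[ub _] /bC[_ vb]].
- rewrite bg2 -[RHS]LR1; apply: eq_bigr => uv _; by rewrite !mulrA.
- by rewrite mulrBl mul1r idem subrr.
- by move=> uv /sq[/bC[_ ub] /bC[vb _]].
Qed.


End OrthogonalDecomposition.

(** * Signed diagrams over a family of generators *)

Section Diagrams.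
Variable A : nzRingType.
Implicit Types (q : nat -> A) (D : seq bool) (e : bool).

Definition signed_gen q e (i : nat) : A := if e then q i else 1 - q i.

Definition starts_block D (i : nat) : bool :=
  (i == 0%N) || (nth false D i.-1 != nth false D i).

(** The distance from i to the next node of opposite sign, or to the end of D if there is none. It
    is the size of a block only when i is its first node. *)
Definition block_size D (i : nat) : nat :=
  find (predC1 (nth false D i)) (drop i D).

Definition wblock q D (i : nat) : A :=
  wlong (signed_gen q (nth false D i)) i (block_size D i).

Definition Lprod q D : A :=
  \prod_(i <- iota 0 (size D) | starts_block D i) wblock q D i.

Definition Rprod q D : A :=
  \prod_(i <- rev (iota 0 (size D)) | starts_block D i) wblock q D i.

Lemma signed_genP q e : hecke_family q -> hecke_family (signed_gen q e).
Proof. by case: e => // /hecke_family_compl. Qed.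

Lemma orth_decomp_signed q e a L R :
  orth_decomp (signed_gen q e) a L R -> orth_decomp q a L R.
Proof.
case: e => // /orth_decomp_compl; congr orth_decomp.
by apply/funext => i; rewrite /signed_gen subKr.
Qed.

Lemma orth_decomp_unsigned q e a L R :
  orth_decomp q a L R -> orth_decomp (signed_gen q e) a L R.
Proof. by case: e => // /orth_decomp_compl. Qed.

Lemma starts_block_cat D D' i : (i < size D)%N ->
  starts_block (D ++ D') i = starts_block D i.
Proof. by move=> iD; rewrite /starts_block !nth_cat iD (leq_ltn_trans (leq_pred i)). Qed.

Lemma block_size_le D i : (i <= size D)%N -> (i + block_size D i <= size D)%N.
Proof. by move=> iD; rewrite -leq_subRL // -size_drop find_size. Qed.

Section LastBlock.
Variables (D : seq bool) (e : bool) (l : nat).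
(** Either D is empty or it ends with the opposite sign, so the appended run is a whole block. *)
Hypothesis De : last (~~ e) D = ~~ e.
Local Notation D' := (D ++ nseq l.+1 e).

(** A run that reaches the end of D has sign [~~ e], so the first appended sign stops it there. *)
Lemma block_size_cat i : (i < size D)%N -> block_size D' i = block_size D i.
Proof.
move=> iD; rewrite /block_size drop_cat nth_cat iD find_cat.
case: ifP => // /negbT; rewrite -all_predC => Dall.
have : last (~~ e) D = nth false D i.
  have := mem_last (nth false D i) (behead (drop i D)).
  have dE := drop_nth false iD; rewrite dE /=.
  have -> : last (~~ e) D = last (nth false D i) (drop i.+1 D).
    by rewrite -{1}(cat_take_drop i D) last_cat dE.
  by rewrite -dE => /(allP Dall) /negPn/eqP.
rewrite De => eE; rewrite [RHS]hasNfind -?all_predC // -eE.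
by rewrite (_ : find _ _ = 0%N) ?addn0 //=; case: (e).
Qed.

Lemma starts_block_last : starts_block D' (size D).
Proof.
rewrite /starts_block; case: (posnP (size D)) => //= D0.
rewrite !nth_cat ltnn subnn prednK // leqnn.
by rewrite (set_nth_default (~~ e)) ?prednK // nth_last De; case: (e).
Qed.

Lemma block_size_last : block_size D' (size D) = l.+1.
Proof.
rewrite /block_size drop_size_cat // nth_cat ltnn subnn /= eqxx /=.
congr S; rewrite hasNfind ?size_nseq // -all_predC.
by apply/allP => x /nseqP[-> _] /=; rewrite eqxx.
Qed.

Lemma starts_block_last_inner i : 
  (size D < i < size D + l.+1)%N -> starts_block D' i = false.
Proof.
move=> iD; rewrite /starts_block !nth_cat !nth_nseq.
have -> : (i < size D)%N = false by lia.
have -> : (i.-1 < size D)%N = false by lia.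
have -> : (i - size D < l.+1)%N by lia.
have -> : (i.-1 - size D < l.+1)%N by lia.
by rewrite eqxx orbF; lia.
Qed.

Lemma wblock_last q : wblock q D' (size D) = wlong (signed_gen q e) (size D) l.+1.
Proof. by rewrite /wblock block_size_last nth_cat ltnn subnn. Qed.

Lemma iota_last : 
  iota 0 (size D') = iota 0 (size D) ++ size D :: iota (size D).+1 l.
Proof. by rewrite size_cat size_nseq iotaD. Qed.

Lemma Lprod_last q : 
  Lprod q D' = Lprod q D * wlong (signed_gen q e) (size D) l.+1.
Proof.
rewrite /Lprod iota_last big_cat big_cons starts_block_last wblock_last /=.
rewrite [X in _ * (_ * X)]big1_seq ?mulr1 => [|i /andP[+ iD]]; last first.
  by rewrite starts_block_last_inner //; move: iD; rewrite mem_iota; lia.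
congr (_ * _); rewrite big_seq_cond [RHS]big_seq_cond; apply: eq_big => i.
  by rewrite mem_iota; case: ltnP => //= iD; rewrite starts_block_cat.
rewrite mem_iota => /andP[/= iD _].
by rewrite /wblock nth_cat iD block_size_cat.
Qed.

Lemma Rprod_last q : 
  Rprod q D' = wlong (signed_gen q e) (size D) l.+1 * Rprod q D.
Proof.
rewrite /Rprod iota_last rev_cat rev_cons big_cat big_rcons starts_block_last wblock_last /=.
rewrite [X in X * _ * _]big1_seq ?mul1r => [|i /andP[+ iD]]; last first.
  by rewrite starts_block_last_inner //; move: iD; rewrite mem_rev mem_iota; lia.
congr (_ * _); rewrite big_seq_cond [RHS]big_seq_cond; apply: eq_big => i.
  by rewrite mem_rev mem_iota; case: ltnP => //= iD; rewrite starts_block_cat.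
rewrite mem_rev mem_iota => /andP[/= iD _].
by rewrite /wblock nth_cat iD block_size_cat.
Qed.
End LastBlock.

Lemma last_block_exists D e : exists D0 l,
  rcons D e = D0 ++ nseq l.+1 e /\ last (~~ e) D0 = ~~ e.
Proof.
elim/last_ind: D => [|D x [D0 [l [DE D0e]]]]; first by exists [::], 0%N.
have [<-{x}|xe] := eqVneq e x; last first.
  exists (rcons D x), 0%N; rewrite last_rcons cats1; split=> //.
  by move: xe; case: (e) x => -[].
exists D0, l.+1; split=> //; rewrite DE -cats1 -catA; congr (_ ++ _).
by rewrite -[[:: e]]/(nseq 1 e) -nseqD addn1.
Qed.

(** The two copies of the last block's longest element meet and merge by idempotence. If the new
    node extends a block, one step of the recursion isolates the new generator; if it opens a block,
    the merged element is that generator. *)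
Lemma Cprod_rcons q D e : hecke_family q ->
  Lprod q (rcons D e) * Rprod q (rcons D e) =
  Lprod q D * signed_gen q e (size D) * Rprod q D.
Proof.
move=> qP; have [idem _ _] := signed_genP e qP.
have [D0 [[|l] [DE D0e]]] := last_block_exists D e.
  move: DE; rewrite cats1 => /rcons_inj[->].
  rewrite -cats1 (Lprod_last 0 D0e) (Rprod_last 0 D0e).
  by rewrite wlongS wlong0 mul1r mulr1 addn0 !mulrA -(mulrA (Lprod q D0)) idem.
have {}DE : D = D0 ++ nseq l.+1 e.
  suff /rcons_inj[]: rcons D e = rcons (D0 ++ nseq l.+1 e) e by [].
  by rewrite DE -cats1 -catA -[[:: e]]/(nseq 1 e) -nseqD addn1.
have -> : rcons D e = D0 ++ nseq l.+2 e.
  by rewrite DE -cats1 -catA -[[:: e]]/(nseq 1 e) -nseqD addn1.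
rewrite {}DE (Lprod_last l.+1 D0e) (Rprod_last l.+1 D0e).
rewrite !(Lprod_last l D0e) !(Rprod_last l D0e).
rewrite size_cat size_nseq !mulrA -(mulrA (Lprod q D0) (wlong _ _ l.+2)).
by rewrite (wlong_subl (signed_genP e qP)) // [wlong _ _ l.+2]wlongS !mulrA.
Qed.

(** Strong induction on the size, as each step strips a whole block. The step is made for the
    generators [signed_gen q e], so both signs are treated alike. *)
Lemma orth_decomp_diagram q D e : hecke_family q ->
  orth_decomp q (size D) (Lprod q (rcons D e)) (Rprod q (rcons D e)).
Proof.
move=> qP; have [m] := ubnP (size D).
elim: m D e => // m IHm D e Dm.
have [D0 [l [DE D0e]]] := last_block_exists D e.
have sD : (size D = size D0 + l)%N.
  by move/(congr1 size): DE; rewrite size_rcons size_cat size_nseq; lia.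
rewrite DE Lprod_last // Rprod_last // sD; have qeP := signed_genP e qP.
apply: (@orth_decomp_signed _ e); case/lastP: D0 => [|D0 x] in DE D0e sD *.
  rewrite /Lprod /Rprod !big_nil mul1r mulr1; exact: orth_decomp_first.
rewrite size_rcons addSnnS; apply: orth_decomp_step => //.
by apply/orth_decomp_unsigned/IHm; move: sD Dm; rewrite size_rcons; lia.
Qed.

Lemma Cprod_orthogonal q D e : hecke_family q ->
  let C e := Lprod q (rcons D e) * Rprod q (rcons D e) in
  C e * C (~~ e) = 0.
Proof.
move=> qP /=; rewrite !Cprod_rcons //.
have [idem _ _] := qP.
suff [] : Lprod q D * q (size D) * Rprod q D *
    (Lprod q D * (1 - q (size D)) * Rprod q D) = 0 /\
  Lprod q D * (1 - q (size D)) * Rprod q D *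
    (Lprod q D * q (size D) * Rprod q D) = 0 by case: e.
(* For empty D there is no earlier node to braid with, and the claim is b (1 - b) = 0 = (1 - b)
   b. *)
case/lastP: D => [|D x].
  rewrite /Lprod /Rprod !big_nil !mul1r !mulr1 mulrBr mulrBl mulr1 mul1r.
  by rewrite idem subrr.
by rewrite size_rcons; apply: orth_decomp_orthogonal => //; apply: orth_decomp_diagram.
Qed.

Lemma Cprod_siblings q D : hecke_family q ->
  Lprod q (rcons D true) * Rprod q (rcons D true) +
  Lprod q (rcons D false) * Rprod q (rcons D false) = Lprod q D * Rprod q D.
Proof.
move=> qP; rewrite !Cprod_rcons // -mulrDl -mulrDr /signed_gen.
by rewrite addrC subrK mulr1.
Qed.

End Diagrams.

Section DiagramMorphism.
Variables (A B : nzRingType) (f : {rmorphism A -> B}).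
Variables (q : nat -> A) (r : nat -> B) (D : seq bool).
Hypothesis qr : forall i, (i < size D)%N -> f (q i) = r i.

Lemma wblock_rmorph i : (i < size D)%N -> f (wblock q D i) = wblock r D i.
Proof.
move=> iD; apply: wlong_rmorph => j ij; have := block_size_le (ltnW iD).
by rewrite /signed_gen; case: ifP => _ ?; rewrite ?rmorphB ?rmorph1 qr //; lia.
Qed.

Lemma Lprod_rmorph : f (Lprod q D) = Lprod r D.
Proof.
rewrite rmorph_prod [LHS]big_seq_cond [RHS]big_seq_cond.
apply: eq_bigr => i; rewrite mem_iota => /andP[/= iD _].
exact: wblock_rmorph.
Qed.

Lemma Rprod_rmorph : f (Rprod q D) = Rprod r D.
Proof.
rewrite rmorph_prod [LHS]big_seq_cond [RHS]big_seq_cond.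
apply: eq_bigr => i; rewrite mem_rev mem_iota => /andP[/= iD _].
exact: wblock_rmorph.
Qed.

End DiagramMorphism.

(** * Normal forms and lengths in the 0-Hecke monoid *)

Section Codes.

(* The permutations of S_(n+1) are encoded by their Lehmer codes: the list   *)
(* [:: m_(n-1); ...; m_0] stands for the normal form c_0 c_1 ... c_(n-1),    *)
(* where c_k is the descending run of the generators k, k-1, ..., m_k (empty *)
(* if m_k = k + 1). *)
Fixpoint code_word (c : seq nat) : seq nat :=
  if c is m :: c' then code_word c' ++ rev (iota m ((size c').+1 - m)) else [::].

Fixpoint is_code (c : seq nat) : bool :=
  if c is m :: c' then (m <= (size c').+1)%N && is_code c' else true.

(** Right multiplication of a normal form by generator i, compared with its last run, which ends at
    m. The generator commutes past the run, extends it, is absorbed by it, or crosses it and becomes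
    generator i - 1. *)
Fixpoint act (c : seq nat) (i : nat) : seq nat :=
  if c is m :: c' then
    if (i.+1 < m)%N then m :: act c' i
    else if i.+1 == m then i :: c'
    else if i == m then c
    else m :: act c' i.-1
  else [::].

(** The code of the identity: every run is empty. *)
Definition code1 (n : nat) : seq nat := rev (iota 1 n).

Lemma rev_iotaS m s : rev (iota m s.+1) = (m + s)%N :: rev (iota m s).
Proof. by rewrite -addn1 iotaD rev_cat. Qed.

Lemma size_act c i : size (act c i) = size c.
Proof. by elim: c i => //= m c IHc i; do ![case: ifP => _] => //=; rewrite IHc. Qed.

Lemma is_code_act c i : is_code c -> is_code (act c i).
Proof.
elim: c i => //= m c IHc i /andP[mc cP]; case: ifP => _ /=.
  by rewrite size_act mc IHc.
case: ifP => [/eqP im|_] /=; first by rewrite cP andbT; lia.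
by case: ifP => _ /=; rewrite ?size_act mc ?IHc.
Qed.

(** The sum of the code drops by the number of letters in the normal form, so a generator changes
    the length by at most one. *)
Lemma sumn_act c i : act c i = c \/ (sumn (act c i)).+1 = sumn c.
Proof.
elim: c i => [|m c IHc] i /=; first by left.
case: ifP => _ /=; first by case: (IHc i) => [->|/= <-]; [left|right; lia].
case: ifP => [/eqP im|_] /=; first by right; lia.
case: ifP => _ /=; first by left.
by case: (IHc i.-1) => [->|/= <-]; [left|right; lia].
Qed.

Lemma act_lt m c i : (i.+1 < m)%N -> act (m :: c) i = m :: act c i.
Proof. by move=> /= ->. Qed.

Lemma act_extend c i : act (i.+1 :: c) i = i :: c.
Proof. by rewrite /= ltnn eqxx. Qed.

Lemma act_absorb c i : act (i :: c) i = i :: c.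
Proof. by rewrite /= ltnNge leqnSn gtn_eqF //= eqxx. Qed.

Lemma act_gt m c i : (m <= i)%N -> act (m :: c) i.+1 = m :: act c i.
Proof.
move=> mi /=; have -> : (i.+2 < m)%N = false by lia.
by rewrite !gtn_eqF //; lia.
Qed.

Variant act_spec m i : Prop :=
| ActLt of (i.+1 < m)%N
| ActExtend of m = i.+1
| ActAbsorb of m = i
| ActGt i' of i = i'.+1 & (m <= i')%N.

Lemma actP m i : act_spec m i.
Proof.
case: (ltngtP i.+1 m) => [|mi|<-]; [exact: ActLt | | exact: ActExtend].
case: i mi => [|i] mi; first by apply: ActAbsorb; lia.
by move: mi; rewrite ltnS leq_eqVlt => /predU1P[|mi]; [exact: ActAbsorb | apply: (@ActGt _ _ i)].
Qed.

Lemma act_idem c i : act (act c i) i = act c i.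
Proof.
elim: c i => // m c IHc i; case: (actP m i) => [im|->|->|{}i -> mi].
- by rewrite !act_lt // IHc.
- by rewrite act_extend act_absorb.
- by rewrite !act_absorb.
- by rewrite !act_gt // IHc.
Qed.

Lemma act_comm c i j : (i.+1 < j)%N -> act (act c i) j = act (act c j) i.
Proof.
elim: c i j => // m c IHc i j ij; case: (actP m i) => [im|->|->|i' ii mi].
- case: (actP m j) => [jm|mj|mj|j' jj mj].
  + by rewrite !act_lt // IHc.
  + by rewrite act_lt // mj !act_extend act_lt //; lia.
  + by rewrite act_lt // mj !act_absorb act_lt //; lia.
  by rewrite jj act_lt // !act_gt // act_lt // IHc //; lia.
- case: j ij => // j ij.
  by rewrite act_extend !act_gt ?act_extend //; lia.
- case: j ij => // j ij.
  by rewrite act_absorb !act_gt ?act_absorb //; lia.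
case: j ij => // j; rewrite ii => ij.
by rewrite !act_gt 1?IHc //; lia.
Qed.

Lemma act_braid c i :
  act (act (act c i) i.+1) i = act (act (act c i.+1) i) i.+1.
Proof.
elim: c i => // m c IHc i; case: (actP m i) => [im|->|->|{}i -> mi].
- have [im'|mE] : (i.+2 < m)%N \/ m = i.+2 by lia.
    by rewrite !act_lt // IHc.
  by rewrite mE act_lt // !act_extend act_gt // act_lt.
- by rewrite act_extend act_gt // act_absorb act_absorb act_extend act_gt.
- by rewrite act_absorb act_gt // !act_absorb act_gt // act_idem.
- by rewrite !act_gt ?(leqW mi) // IHc.
Qed.

Lemma size_code_word c : is_code c ->
  (size (code_word c) + sumn c = sumn (code1 (size c)))%N.
Proof.
elim: c => //= m c IHc /andP[mc /IHc].
by rewrite /code1 rev_iotaS size_cat size_rev size_iota /= => <-; lia.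
Qed.

Lemma is_code1 n : is_code (code1 n).
Proof. by elim: n => //= n IHn; rewrite /code1 rev_iotaS /= IHn size_rev size_iota leqnn. Qed.

Lemma code_word1 n : code_word (code1 n) = [::].
Proof.
elim: n => //= n IHn; rewrite /code1 rev_iotaS /= IHn size_rev size_iota.
by rewrite addnC addn1 subnn.
Qed.

Variables (A : nzRingType) (q : nat -> A).
Hypothesis qP : hecke_family q.

Lemma prod_run_comm m s i : (i.+1 < m)%N || (m + s < i)%N -> 
  GRing.comm (q i) (\prod_(j <- rev (iota m s)) q j).
Proof.
move=> ims; rewrite big_seq; apply: (big_ind (GRing.comm (q i))) => [|x y|j].
- exact: commr1.
- exact: commrM.
rewrite mem_rev mem_iota => jms; case/orP: ims => ?.
  by apply: comm_q => //; lia.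
by apply/commr_sym/comm_q => //; lia.
Qed.

(** Inside the run, q i commutes with every letter below i - 1, braids with the letters i and i - 1,
    and leaves as q (i - 1), which commutes with the letters above i. *)
Lemma prod_run_shift m s i : (m < i < m + s)%N ->
  (\prod_(j <- rev (iota m s)) q j) * q i =
  q i.-1 * \prod_(j <- rev (iota m s)) q j.
Proof.
have [_ comm braid] := qP.
elim: s => [|s IHs] ims; first lia.
rewrite rev_iotaS big_cons; have [ims'|ims'] := ltnP i (m + s).
  rewrite -mulrA IHs; last lia.
  by rewrite !mulrA -comm //; lia.
case: s => [|s] in IHs ims ims' *; first lia.
rewrite rev_iotaS big_cons.
have -> : i = (m + s).+1 by lia.
rewrite addnS -!mulrA -prod_run_comm ?mulrA ?braid //; lia.
Qed.

Lemma code_wordM c i : is_code c -> (i < size c)%N ->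
  (\prod_(j <- code_word c) q j) * q i = \prod_(j <- code_word (act c i)) q j.
Proof.
have [idem comm braid] := qP.
elim: c i => // m c IHc i /andP[mc cP] ic; have {}ic : (i < (size c).+1)%N by [].
case: (actP m i) => [im|mE|mE|i' iE mi].
- rewrite act_lt //= !big_cat size_act /= -IHc //; last lia.
  by rewrite -!mulrA -prod_run_comm // im.
- rewrite mE act_extend /= !big_cat -mulrA; congr (_ * _).
  by rewrite subSS subSn -1?ltnS -?mE //= rev_cons big_rcons /= mE.
- rewrite mE act_absorb /= !big_cat -mulrA; congr (_ * _).
  by rewrite subSn //= rev_cons big_rcons /= -mulrA idem.
rewrite iE act_gt //= !big_cat size_act /= -IHc //; last lia.
by rewrite -!mulrA prod_run_shift //; lia.
Qed.

End Codes.

(* Padding by 1 makes the relations hold for all indices. *)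
Definition pad (A : nzRingType) (n : nat) (f : 'I_n -> A) (i : nat) : A :=
  oapp f 1 (insub i).

Lemma pad_val (A : nzRingType) (n : nat) (f : 'I_n -> A) (i : 'I_n) : pad f i = f i.
Proof. by rewrite /pad valK. Qed.

Lemma pad_family (K : comNzRingType) (A : algType K) (n : nat) (f : 'I_n -> A) :
  hecke_compatible f -> hecke_family (pad f).
Proof.
case=> idem comm braid; split=> [i|i j ij|i]; rewrite /pad; case: insubP => [k _ kE|ni] /=.
- exact: idem.
- exact: mulr1.
- case: insubP => [l _ lE|_] /=; last by rewrite mulr1 mul1r.
  by apply: comm; rewrite kE lE.
- by rewrite mul1r mulr1.
- case: insubP => [l _ lE|_] /=; first by rewrite braid // kE lE.
  by rewrite !mulr1 mul1r idem.
case: insubP => [l li|_] /=; last by rewrite !mulr1.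
by move: ni li; lia.
Qed.

Section Generators.
Variables (K : comNzRingType) (n : nat).

Definition gen_nat : nat -> heckealg K n := pad (hgen K (n := n)).

Lemma gen_nat_val (i : 'I_n) : gen_nat i = hgen K i.
Proof. exact: pad_val. Qed.

Lemma gen_nat_family : hecke_family gen_nat.
Proof. exact: pad_family (hgen_compatible K n). Qed.

Lemma hbasis_hword (s : seq 'I_n) :
  hbasis K (hword s) = \prod_(i <- map val s) gen_nat i.
Proof.
elim: s => [|i s IHs]; first by rewrite big_nil hbasis1.
by rewrite big_cons -IHs gen_nat_val -cat1s hword_cat -hbasisM.
Qed.

Lemma prod_gen_nat (t : seq nat) :
  \prod_(j <- t) gen_nat j = hbasis K (hword (pmap insub t : seq 'I_n)).
Proof.
elim: t => [|j t IHt]; first by rewrite big_nil hbasis1.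
rewrite big_cons IHt /= /gen_nat /pad; case: insub => [i|] /=; last by rewrite mul1r.
by rewrite -[in RHS]cat1s hword_cat -hbasisM.
Qed.

Lemma hbasis_inj : injective (@hbasis K n).
Proof.
move=> x y xy; apply/eqP; have := oner_neq0 K; apply: contraNT => xny.
move: xy; rewrite hbasis.unlock => /(congr1 (mcoeff x)).
by rewrite mcoeffUU mcoeffU eq_sym (negbTE xny) => ->.
Qed.

End Generators.

Section Length.
Variable n : nat.
Implicit Types (s t : seq 'I_n) (x y : hecke n) (J : {set 'I_n}).

Definition code s : seq nat := foldl act (code1 n) (map val s).

Lemma code_rcons s i : code (rcons s i) = act (code s) i.
Proof. by rewrite /code map_rcons foldl_rcons. Qed.

Lemma codeP s : is_code (code s) /\ size (code s) = n.
Proof.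
elim/last_ind: s => [|s i [sP ss]].
  by rewrite /code /= is_code1 size_rev size_iota.
by rewrite code_rcons is_code_act // size_act.
Qed.

Lemma code_cong s t : hecke_cong s t -> code s = code t.
Proof.
rewrite /code; elim=> {s t} // => [u v s t st|s t u _ -> _ ->] //.
rewrite !map_cat !foldl_cat; congr foldl.
case: st => [i|i j ij|i j ij] /=; rewrite ?act_idem 1?(act_comm _ ij) //.
by rewrite ij act_braid.
Qed.

Lemma code_word_code s : hword s = hword (pmap insub (code_word (code s))).
Proof.
(* [code_wordM] concerns products in a ring, so the monoid is embedded in its algebra over the
   integers. *)
apply: (@hbasis_inj int); rewrite hbasis_hword -prod_gen_nat.
elim/last_ind: s => [|s i IHs]; first by rewrite /code /= code_word1.
have [sP ss] := codeP s.
rewrite map_rcons -cats1 big_cat big_seq1 /= IHs code_rcons code_wordM ?ss //.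
exact: gen_nat_family.
Qed.

Lemma hlength_le s : (hlength (hword s) <= size s)%N.
Proof.
by rewrite /hlength; case: ex_minnP => k _; apply; apply/asboolP; exists s.
Qed.

Lemma hlength_word x : exists2 s, hword s = x & size s = hlength x.
Proof.
by rewrite /hlength; case: ex_minnP => k /asboolP[s [<- <-]] _; exists s.
Qed.

(** The normal form bounds the length from above. Conversely, each letter of a shortest word lowers
    the sum of the code by at most one. *)
Lemma hlength_code s : (hlength (hword s) + sumn (code s) = sumn (code1 n))%N.
Proof.
have [sP ss] := codeP s; have := size_code_word sP; rewrite ss => <-.
apply/eqP; rewrite eqn_add2r eqn_leq; apply/andP; split.
  rewrite [hword s]code_word_code (leq_trans (hlength_le _)) //.
  by rewrite size_pmap; apply: count_size.
have [t ts <-] := hlength_word (hword s).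
rewrite -(leq_add2r (sumn (code s))) size_code_word // ss.
rewrite -(code_cong (iffLR (hwordP _ _) ts)).
elim/last_ind: t {ts} => [|t i IHt]; first by rewrite /code.
by rewrite code_rcons size_rcons; case: (sumn_act (code t) i) => [->|]; lia.
Qed.

Lemma hlength_hmul_gen x (i : 'I_n) : hmul x (hword [:: i]) = x \/
  hlength (hmul x (hword [:: i])) = (hlength x).+1.
Proof.
rewrite -(hword_repr x) -hword_cat cats1; set s := repr x.
case: (sumn_act (code s) i); rewrite -code_rcons => sE.
  by left; rewrite code_word_code sE -code_word_code.
by right; have := hlength_code s; have := hlength_code (rcons s i); lia.
Qed.

Lemma hlength_hmul x y : (hlength x <= hlength (hmul x y))%N.
Proof.
rewrite -(hword_repr y); elim/last_ind: (repr y) => [|s i IHs].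
  by rewrite [hmul _ _]hmulr1.
rewrite -cats1 hword_cat hmulA (leq_trans IHs) //.
by case: (hlength_hmul_gen (hmul x (hword s)) i) => ->.
Qed.

(** Any y in the submonoid satisfies y x = x, so it is no longer than x. If y also has maximal
    length, right multiplication by generators of J cannot lengthen it, so y = y x = x. *)
Lemma longestE J x : in_submonoid J x ->
  {in J, forall i, hmul (hword [:: i]) x = x} -> longest J = x.
Proof.
move=> Jx absx.
have absy y : in_submonoid J y -> hmul y x = x.
  case=> s [Js ->]; elim: s Js => [|i s IHs] /=; first by rewrite [hmul _ _]hmul1.
  by case/andP=> iJ /IHs; rewrite -cat1s hword_cat -hmulA => ->; apply: absx.
apply: xget_unique => /=.
  by split=> // y /absy <-; apply: hlength_hmul.
move=> y [Jy maxy]; rewrite -[RHS](absy y Jy).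
have [s [Js ->]] := Jx; elim/last_ind: s Js => [|s i IHs].
  by rewrite [hmul _ _]hmulr1.
rewrite all_rcons => /andP[iJ /IHs ys]; rewrite -cats1 hword_cat hmulA -ys.
have [//|] := hlength_hmul_gen y i.
have := maxy (hmul y (hword [:: i])); case: Jy => t [Jt ->] /=.
rewrite -hword_cat => maxt hl; exfalso.
suff /maxt : in_submonoid J (hword (t ++ [:: i])) by rewrite hl ltnn.
by exists (t ++ [:: i]); rewrite all_cat Jt /= iJ.
Qed.

End Length.

(** * Diagram demipotents of the 0-Hecke algebra *)

Section LongestBlock.
Variables (K : comNzRingType) (n : nat).
Local Notation g := (gen_nat K n).

Lemma hbasis_longest k l : (k + l <= n)%N ->
  hbasis K (longest [set i : 'I_n | (k <= i < k + l)%N]) = wlong g k l.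
Proof.
move=> kln; set J := [set _ | _]; have gP := gen_nat_family K n.
have [s Js sE] : exists2 s : seq 'I_n, all (mem J) s & hbasis K (hword s) = wlong g k l.
  have : forall l', (l' <= l)%N -> exists2 s : seq 'I_n,
      all (mem J) s & hbasis K (hword s) = wlong g k l'.
    elim=> [_|l' IHl' l'l]; first by exists [::]; rewrite ?hbasis1 ?wlong0.
    have kl'n : (k + l' < n)%N by lia.
    have [s Js sE] := IHl' (ltnW l'l).
    exists (s ++ Ordinal kl'n :: s).
      by rewrite all_cat /= Js !inE /=; apply/andP; split=> //; lia.
    rewrite -cat1s !hword_cat wlongS -sE -[X in _ * g X * _]/(val (Ordinal kl'n)).
    by rewrite gen_nat_val -mulrA !hbasisM.
  exact.
rewrite (@longestE _ J (hword s)) //; first by exists s.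
move=> i; rewrite inE => ikl; apply: (@hbasis_inj K).
by rewrite -[hmul _ _]/(mmul _ _) -hbasisM sE -/(hgen K i) -gen_nat_val q_wlong.
Qed.

Lemma wsign_interval e k l : (k + l <= n)%N ->
  wsign K e [set i : 'I_n | (k <= i < k + l)%N] = wlong (signed_gen g e) k l.
Proof.
move=> kln; rewrite /wsign /= hbasis_longest //; case: e => //.
apply: wlong_rmorph => j jkl; have nj : (j < n)%N by lia.
by rewrite -[j]/(val (Ordinal nj)) /signed_gen gen_nat_val /= hPsi_hgen.
Qed.

End LongestBlock.

Section Blocks.
Variables (n : nat) (D : sdiagram n).

Lemma block_firstE (i : 'I_n) : block_first D i = starts_block D i.
Proof.
apply/forallP/idP => [/= first_i|i_first j]; last first.
  apply/implyP; rewrite inE => /forallP ij; rewrite leqNgt; apply/negP => ji.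
  (* The node before i lies between j and i, so it would have the sign of i, although i starts a
     block. *)
  have i'n : (i.-1 < n)%N by have := ltn_ord i; lia.
  have := ij (Ordinal i'n); rewrite /= !(tnth_nth false) /=.
  rewrite (_ : (minn i j <= i.-1 <= maxn i j)%N) /=; last by lia.
  by move: i_first; rewrite /starts_block; case: eqP => [|_ /= /negbTE ->] //; lia.
rewrite /starts_block; case: posnP => //= i0; apply/negP => /eqP ii'.
have i'n : (i.-1 < n)%N by have := ltn_ord i; lia.
suff : (i <= i.-1)%N by lia.
apply: (implyP (first_i (Ordinal i'n))); rewrite inE; apply/forallP => k.
apply/implyP => /= ik; rewrite !(tnth_nth false).
have [->//|->] : (k : nat) = i \/ (k : nat) = i.-1 by lia.
by rewrite ii'.
Qed.

Lemma blockE (i : 'I_n) : starts_block D i ->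
  block D i = [set j : 'I_n | (i <= j < i + block_size D i)%N].
Proof.
rewrite -block_firstE => first_i; apply/setP => j; rewrite !inE.
have le_ij : j \in block D i -> (i <= j)%N.
  by move=> jb; apply: (implyP (forallP first_i j)).
have sD : size D = n by rewrite size_tuple.
apply/forallP/andP => [ij|[ij jb] k].
  have leij : (i <= j)%N by apply: le_ij; rewrite inE; apply/forallP.
  split=> //; rewrite ltnNge; apply/negP => bj.
  have bs : (i + block_size D i < n)%N by apply: leq_ltn_trans bj (ltn_ord j).
  have has_b : has (predC1 (nth false D i)) (drop i D).
    by rewrite has_find size_drop -/(block_size D i) sD; lia.
  have := nth_find false has_b; rewrite nth_drop -/(block_size D i) /=.
  have := ij (Ordinal bs); rewrite !(tnth_nth false) /=.
  by rewrite (_ : (minn i j <= _ <= maxn i j)%N) /= => [->|]; lia.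
apply/implyP => /= ikj; rewrite !(tnth_nth false).
have ik : (i <= k)%N by lia.
have := @before_find _ false (predC1 (nth false D i)) (drop i D) (k - i).
rewrite nth_drop subnKC // -/(block_size D i) /= => /(_ _) /negbT.
by rewrite negbK; apply; lia.
Qed.

Variable K : comNzRingType.

Lemma wsign_block (i : 'I_n) : starts_block D i ->
  wsign K (tnth D i) (block D i) = wblock (gen_nat K n) D i.
Proof.
move=> /blockE ->; rewrite wsign_interval ?(tnth_nth false) //.
by rewrite -[leqRHS](size_tuple D) block_size_le // size_tuple ltnW.
Qed.

Lemma L_diagramE : L_diagram K D = Lprod (gen_nat K n) D.
Proof.
rewrite /L_diagram /Lprod size_tuple -val_enum_ord big_map.
by apply: eq_big => i; [exact: block_firstE | rewrite block_firstE => /wsign_block].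
Qed.

Lemma R_diagramE : R_diagram K D = Rprod (gen_nat K n) D.
Proof.
rewrite /R_diagram /Rprod size_tuple -val_enum_ord -map_rev big_map.
by apply: eq_big => i; [exact: block_firstE | rewrite block_firstE => /wsign_block].
Qed.

Lemma C_diagramE : 
  C_diagram K D = Lprod (gen_nat K n) D * Rprod (gen_nat K n) D.
Proof. by rewrite /C_diagram L_diagramE R_diagramE. Qed.

(** The products for D involve only the first n generators, which [hincl] preserves, so C_D in the
    larger algebra is given by the same list of signs. *)
Lemma hincl_C_diagram : hincl (C_diagram K D) =
  Lprod (gen_nat K n.+1) D * Rprod (gen_nat K n.+1) D.
Proof.
have gE i : (i < size D)%N -> hincl (gen_nat K n i) = gen_nat K n.+1 i.
  rewrite size_tuple => ni; rewrite -[i in LHS]/(val (Ordinal ni)) gen_nat_val hincl_hgen.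
  by rewrite -gen_nat_val.
rewrite C_diagramE rmorphM /=.
by rewrite (Lprod_rmorph gE) (Rprod_rmorph gE).
Qed.

End Blocks.

Lemma orthogonal_sum (A : nzRingType) (c x y : A) :
    x + y = c -> x * y = 0 -> y * x = 0 ->
  (y * x = x * y /\ x * y = 0) /\ (c * x = x * c /\ x * c = x ^+ 2) /\
  (c * y = y * c /\ y * c = y ^+ 2).
Proof.
by move=> <- xy0 yx0; rewrite !mulrDl !mulrDr xy0 yx0 !addr0 !add0r !expr2.
Qed.

Unset Implicit Arguments.
Set Strict Implicit.

Theorem lemma4p3 (R : realType) (n : nat) (D : sdiagram n) :
  let C_D : heckealg R[i] n.+1 := hincl (C_diagram R[i] D) in
  let C_Dp : heckealg R[i] n.+1 := C_diagram R[i] (adjoin_node D true) in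
  let C_Dm : heckealg R[i] n.+1 := C_diagram R[i] (adjoin_node D false) in
  (C_Dm * C_Dp = C_Dp * C_Dm /\ C_Dp * C_Dm = 0) /\
  (C_D * C_Dp = C_Dp * C_D /\ C_Dp * C_D = C_Dp ^+ 2) /\
  (C_D * C_Dm = C_Dm * C_D /\ C_Dm * C_D = C_Dm ^+ 2).
Proof.
move=> C_D C_Dp C_Dm; have gP := gen_nat_family R[i] n.+1.
rewrite {}/C_D {}/C_Dp {}/C_Dm hincl_C_diagram !C_diagramE.
apply: orthogonal_sum.
- exact: Cprod_siblings D gP.
- exact: (Cprod_orthogonal D true gP).
- exact: (Cprod_orthogonal D false gP).
Qed.
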